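(* Let $u: U \to \mathbb{R}$ be a smooth function on an open set $U\subset\mathbb{R}^{2}$ such that $\mathrm{Hess}(u)$ is positive definite and $\det \mathrm{Hess}(u) = 1$ everywhere. Let $g$ denote the associated Hessian metric on $U$, $g|_x=\mathrm{Hess}(u)|_x$, with Laplace-Beltrami operator $\Delta$ and scalar curvature $R \geq 0$. Then, for all $\alpha >0$, $$\Delta R^{\alpha}\geq 3\alpha R^{\alpha+1}$$ holds in the barrier sense on $U$. Moreover, equality can be attained at a point where $R > 0$: for every $\alpha>0$ there exist an open set $U\subset\mathbb{R}^2$, a smooth function $u:U\to\mathbb{R}$ with $\mathrm{Hess}(u)$ positive definite and $\det\mathrm{Hess}(u)=1$ everywhere, and a point $p\in U$ such that the Laplace-Beltrami operator $\Delta$ and the scalar curvature $R$ of the Hessian metric $g|_x=\mathrm{Hess}(u)|_x$ satisfy $R(p)>0$ and $(\Delta R^\alpha)(p)=3\alpha R(p)^{\alpha+1}$.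
   Context: The Laplace-Beltrami operator is $\Delta=\mathrm{div}_g\nabla_g$ (so $\Delta=\partial_x^2+\partial_y^2$ for the Euclidean metric), and the scalar curvature is the trace of the Ricci tensor (twice the Gaussian curvature). For continuous functions $v,w$ on $U$, the inequality $\Delta v\geq w$ holds in the (lower) barrier sense if for every $p\in U$ and every $\varepsilon>0$ there exists a $C^2$ function $\varphi$ defined near $p$ with $\varphi\leq v$ near $p$, $\varphi(p)=v(p)$ and $\Delta\varphi(p)\geq w(p)-\varepsilon$. *)

(* Defs.v *)
From Stdlib Require Import Reals.
From Coquelicot Require Import Coquelicot.
Open Scope R_scope.

(* Functions and tensor components on subsets of R^2 are total curried maps
   R -> R -> R, as in Coquelicot's two-dimensional calculus; only their values
   on the open set under consideration matter. *)

Inductive coord : Set := X1 | X2.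

Definition sumc (F : coord -> R) : R := F X1 + F X2.

Definition pd (i : coord) (f : R -> R -> R) (x y : R) : R :=
  match i with
  | X1 => Derive (fun t => f t y) x
  | X2 => Derive (fun t => f x t) y
  end.

(* [ex_diff_n] is a condition on derivatives at one point; being C^n on an open
   set means that it holds at every point of that set. *)
Definition smooth_on (U : R * R -> Prop) (f : R -> R -> R) : Prop :=
  forall n x y, U (x, y) -> ex_diff_n f n x y.

Definition C2_near (f : R -> R -> R) (x y : R) : Prop :=
  locally_2d (ex_diff_n f 2) x y.

Definition continuous_on_2d (U : R * R -> Prop) (f : R -> R -> R) : Prop :=
  forall x y, U (x, y) -> continuity_2d_pt f x y.

Definition tensor2 : Type := coord -> coord -> R -> R -> R.

Definition Hess (u : R -> R -> R) : tensor2 := fun i j => pd i (pd j u).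

Definition det2 (g : tensor2) (x y : R) : R :=
  g X1 X1 x y * g X2 X2 x y - g X1 X2 x y * g X2 X1 x y.

Definition pos_def (g : tensor2) (x y : R) : Prop :=
  forall v : coord -> R, (exists i, v i <> 0) ->
  0 < sumc (fun i => sumc (fun j => g i j x y * v i * v j)).

Definition ginv (g : tensor2) : tensor2 := fun i j x y =>
  match i, j with
  | X1, X1 => g X2 X2 x y
  | X1, X2 => - g X1 X2 x y
  | X2, X1 => - g X2 X1 x y
  | X2, X2 => g X1 X1 x y
  end / det2 g x y.

(* [Christoffel g k i j] is Gamma^k_{ij}. *)
Definition Christoffel (g : tensor2) (k i j : coord) (x y : R) : R :=
  / 2 * sumc (fun l => ginv g k l x y *
          (pd i (g j l) x y + pd j (g i l) x y - pd l (g i j) x y)).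

(* [Riemann g l i j k] is the d_l-component of
   nabla_i nabla_j d_k - nabla_j nabla_i d_k. *)
Definition Riemann (g : tensor2) (l i j k : coord) (x y : R) : R :=
  pd i (Christoffel g l j k) x y - pd j (Christoffel g l i k) x y
  + sumc (fun m => Christoffel g l i m x y * Christoffel g m j k x y
                 - Christoffel g l j m x y * Christoffel g m i k x y).

(* Ric(Y,Z) = tr (X |-> R(X,Y)Z): with this sign, round spheres have positive
   Ricci curvature. *)
Definition Ricci (g : tensor2) : tensor2 := fun j k x y =>
  sumc (fun i => Riemann g i i j k x y).

Definition scalar_curvature (g : tensor2) (x y : R) : R :=
  sumc (fun j => sumc (fun k => ginv g j k x y * Ricci g j k x y)).

Definition gradient (g : tensor2) (f : R -> R -> R) (i : coord) (x y : R) : R :=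
  sumc (fun j => ginv g i j x y * pd j f x y).

(* The trace of the covariant derivative of the vector field V. *)
Definition divergence (g : tensor2) (V : coord -> R -> R -> R) (x y : R) : R :=
  sumc (fun i => pd i (V i) x y
                 + sumc (fun k => Christoffel g i i k x y * V k x y)).

Definition LaplaceBeltrami (g : tensor2) (f : R -> R -> R) : R -> R -> R :=
  divergence g (gradient g f).

(* r^a for r >= 0 and a > 0, with 0^a = 0; the library's [Rpower 0 a] is 1. *)
Definition rpow (r a : R) : R := if Rlt_dec 0 r then Rpower r a else 0.

(* Delta_g v >= w on U in the lower barrier sense, a notion reserved to
   continuous v and w. *)
Definition barrier_ge (g : tensor2) (U : R * R -> Prop)
    (v w : R -> R -> R) : Prop :=
  continuous_on_2d U v /\ continuous_on_2d U w /\
  forall x y, U (x, y) -> forall eps : R, 0 < eps ->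
  exists phi : R -> R -> R,
    C2_near phi x y /\
    locally_2d (fun s t => phi s t <= v s t) x y /\
    phi x y = v x y /\
    w x y - eps <= LaplaceBeltrami g phi x y.

(* Main.v *)
From Stdlib Require Import Reals Lra Lia.
From Coquelicot Require Import Coquelicot.
Require Import Defs.
Open Scope R_scope.

(** Write a = u_xx, b = u_xy, c = u_yy, so that a c - b^2 = 1. In the
    coordinates (u_x, y) the Hessian metric is (1/a) times the flat metric,
    because a dx^2 + 2 b dx dy + c dy^2 = ((a dx + b dy)^2 + dy^2) / a, and the
    partial Legendre transform turns the Monge-Ampere equation into the
    statement that m = 1/a is harmonic, say m = Re G with G holomorphic. For
    such a conformal factor R = |G'|^2 / m^3, which in invariant terms is
    R = |grad log a|^2 >= 0 ([scalar_curvature_formula]). Where R > 0, log R is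
    a harmonic function minus 3 log m, and Lap (log m) = - |grad log m|^2 = - R.
    Hence Lap (log R) = 3 R, that is
        R Lap R = |grad R|^2 + 3 R^3          ([curv_Bochner]),
    and the chain rule gives, where R > 0,
        Lap (R^alpha) = 3 alpha R^(alpha+1) + alpha^2 R^(alpha-2) |grad R|^2
    ([LaplaceBeltrami_power]). So R^alpha is its own barrier at a point where
    R > 0; at a zero of R the constant 0 is a barrier, since R^alpha >= 0
    ([scalar_curvature_power_barrier]).

    The same formula shows that equality holds exactly at the critical points
    of R in the region R > 0. With G(z) = z^(-2) the Legendre transform can be
    inverted explicitly and gives u = (log (1 + s) - s) / 2 - log x, where
    s = sqrt (1 - 4 x^2 y^2), with R = 4 / s^3; every point of the axis y = 0
    is critical.

    The identity for R Lap R is checked on jets. Since det Hess u = 1, the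
    inverse metric is polynomial in the second derivatives of u, and so are the
    Christoffel symbols, the curvature and its Laplacian in the derivatives of
    u. A syntax of differential polynomials ([dpoly]) with a formal derivative
    computes them; the derivatives of a c - b^2 = 1 up to order three then
    express every jet of order two to five by those with at most one y, and
    the identity becomes one between rational functions. *)

(** * Partial derivatives and C^n functions on open sets *)

Lemma open_locally_2d (U : R * R -> Prop) (x y : R) :
  open U -> U (x, y) -> locally_2d (fun s t => U (s, t)) x y.
Proof.
  intros HU Hxy. apply locally_2d_locally.
  generalize (HU _ Hxy). apply filter_imp. now intros [s t].
Qed.

Lemma open_locally_2d_imp (U : R * R -> Prop) (P : R -> R -> Prop) (x y : R) :
  open U -> U (x, y) -> (forall s t, U (s, t) -> P s t) -> locally_2d P x y.
Proof.
  intros HU Hxy HP.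
  apply locally_2d_impl with (2 := open_locally_2d U x y HU Hxy).
  now apply locally_2d_forall.
Qed.

Lemma open_and_pos (U : R * R -> Prop) (f : R -> R -> R) :
  open U -> (forall x y, U (x, y) -> continuity_2d_pt f x y) ->
  open (fun z => U z /\ 0 < f (fst z) (snd z)).
Proof.
  intros HU Hf [x y] [Hxy Hpos]. apply filter_and; [now apply HU|].
  assert (Hlim := proj1 (continuity_2d_pt_filterlim f x y) (Hf x y Hxy)).
  exact (Hlim _ (open_gt 0 (f x y) Hpos)).
Qed.

Lemma pd_ext_loc (c : coord) (f g : R -> R -> R) (x y : R) :
  locally_2d (fun s t => f s t = g s t) x y -> pd c f x y = pd c g x y.
Proof.
  intros H. destruct c; apply Derive_ext_loc.
  - exact (locally_2d_1d_const_y _ _ _ H).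
  - exact (locally_2d_1d_const_x _ _ _ H).
Qed.

Lemma pd_ext_on (U : R * R -> Prop) (c : coord) (f g : R -> R -> R) :
  open U -> (forall x y, U (x, y) -> f x y = g x y) ->
  forall x y, U (x, y) -> pd c f x y = pd c g x y.
Proof.
  intros HU H x y Hxy. apply pd_ext_loc.
  now apply open_locally_2d_imp with U.
Qed.

(** [pd] is total, so its value alone does not say that the derivative exists. *)
Definition has_pd (c : coord) (f : R -> R -> R) (x y d : R) : Prop :=
  match c with
  | X1 => is_derive (fun t => f t y) x d
  | X2 => is_derive (fun t => f x t) y d
  end.

Lemma has_pd_unique (c : coord) (f : R -> R -> R) (x y d : R) :
  has_pd c f x y d -> pd c f x y = d.
Proof. destruct c; exact (is_derive_unique _ _ _). Qed.

Lemma has_pd_const (c : coord) (r x y : R) : has_pd c (fun _ _ => r) x y 0.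
Proof. destruct c; exact (is_derive_const r _). Qed.

Lemma has_pd_plus (c : coord) (f g : R -> R -> R) (x y d e : R) :
  has_pd c f x y d -> has_pd c g x y e ->
  has_pd c (fun s t => f s t + g s t) x y (d + e).
Proof.
  destruct c; intros Hf Hg.
  - exact (is_derive_plus (fun s => f s y) (fun s => g s y) x d e Hf Hg).
  - exact (is_derive_plus (fun t => f x t) (fun t => g x t) y d e Hf Hg).
Qed.

Lemma has_pd_mult (c : coord) (f g : R -> R -> R) (x y d e : R) :
  has_pd c f x y d -> has_pd c g x y e ->
  has_pd c (fun s t => f s t * g s t) x y (d * g x y + f x y * e).
Proof.
  destruct c; intros Hf Hg.
  - exact (is_derive_mult (fun s => f s y) (fun s => g s y) x d e Hf Hg Rmult_comm).
  - exact (is_derive_mult (fun t => f x t) (fun t => g x t) y d e Hf Hg Rmult_comm).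
Qed.

Lemma has_pd_comp (c : coord) (h : R -> R) (f : R -> R -> R) (x y d e : R) :
  is_derive h (f x y) e -> has_pd c f x y d ->
  has_pd c (fun s t => h (f s t)) x y (d * e).
Proof.
  destruct c; intros Hh Hf.
  - exact (is_derive_comp h (fun s => f s y) x e d Hh Hf).
  - exact (is_derive_comp h (fun t => f x t) y e d Hh Hf).
Qed.

Definition Cn_on (n : nat) (U : R * R -> Prop) (f : R -> R -> R) : Prop :=
  forall x y, U (x, y) -> ex_diff_n f n x y.

Lemma Cn_on_continuity (n : nat) (U : R * R -> Prop) (f : R -> R -> R) (x y : R) :
  Cn_on n U f -> U (x, y) -> continuity_2d_pt f x y.
Proof. intros H Hxy. specialize (H x y Hxy). destruct n; apply H. Qed.

Lemma Cn_on_le (m n : nat) (U : R * R -> Prop) (f : R -> R -> R) :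
  (m <= n)%nat -> Cn_on n U f -> Cn_on m U f.
Proof. intros Hmn H x y Hxy. exact (ex_diff_n_m n m Hmn f x y (H x y Hxy)). Qed.

Lemma Cn_on_has_pd (n : nat) (U : R * R -> Prop) (f : R -> R -> R) (c : coord) (x y : R) :
  Cn_on (S n) U f -> U (x, y) -> has_pd c f x y (pd c f x y).
Proof.
  intros H Hxy. destruct (H x y Hxy) as (_ & H1 & H2 & _).
  destruct c; now apply Derive_correct.
Qed.

Lemma Cn_on_pd (n : nat) (U : R * R -> Prop) (f : R -> R -> R) (c : coord) :
  Cn_on (S n) U f -> Cn_on n U (pd c f).
Proof. intros H x y Hxy. destruct c; apply (H x y Hxy). Qed.

Lemma Cn_on_ext (n : nat) (U : R * R -> Prop) (f g : R -> R -> R) :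
  open U -> (forall x y, U (x, y) -> f x y = g x y) -> Cn_on n U f -> Cn_on n U g.
Proof.
  intros HU Hfg Hf x y Hxy. apply ex_diff_n_ext_loc with f; [|now apply Hf].
  now apply open_locally_2d_imp with U.
Qed.

(** The induction step of all the C^n closure properties below: on an open set
    the partial derivatives may be replaced by any functions that equal them. *)
Lemma Cn_on_intro (n : nat) (U : R * R -> Prop) (f : R -> R -> R)
    (df : coord -> R -> R -> R) :
  open U -> (forall x y, U (x, y) -> continuity_2d_pt f x y) ->
  (forall c x y, U (x, y) -> has_pd c f x y (df c x y)) ->
  (forall c, Cn_on n U (df c)) -> Cn_on (S n) U f.
Proof.
  intros HU Hc Hd HCn.
  assert (H : forall c, Cn_on n U (pd c f)).
  { intros c. apply Cn_on_ext with (df c); trivial.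
    intros x y Hxy. symmetry. now apply has_pd_unique, Hd. }
  intros x y Hxy. split; [now apply Hc|].
  repeat split.
  - eexists. exact (Hd X1 x y Hxy).
  - eexists. exact (Hd X2 x y Hxy).
  - exact (H X1 x y Hxy).
  - exact (H X2 x y Hxy).
Qed.

Lemma Cn_on_const (n : nat) (U : R * R -> Prop) (r : R) :
  open U -> Cn_on n U (fun _ _ => r).
Proof.
  intros HU. revert r. induction n as [|n IH]; intros r.
  - intros x y _. split; trivial. apply continuity_2d_pt_const.
  - apply Cn_on_intro with (df := fun _ _ _ => 0); trivial.
    + intros. apply continuity_2d_pt_const.
    + intros. apply has_pd_const.
Qed.

Lemma Cn_on_plus (n : nat) (U : R * R -> Prop) (f g : R -> R -> R) :
  open U -> Cn_on n U f -> Cn_on n U g -> Cn_on n U (fun s t => f s t + g s t).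
Proof.
  intros HU. revert f g. induction n as [|n IH]; intros f g Hf Hg.
  - intros x y Hxy. split; trivial.
    apply continuity_2d_pt_plus; [now apply Hf | now apply Hg].
  - apply Cn_on_intro with (df := fun c s t => pd c f s t + pd c g s t); trivial.
    + intros x y Hxy.
      apply continuity_2d_pt_plus; eapply Cn_on_continuity; eassumption.
    + intros c x y Hxy. apply has_pd_plus; eapply Cn_on_has_pd; eassumption.
    + intros c. apply IH; now apply Cn_on_pd.
Qed.

Lemma Cn_on_mult (n : nat) (U : R * R -> Prop) (f g : R -> R -> R) :
  open U -> Cn_on n U f -> Cn_on n U g -> Cn_on n U (fun s t => f s t * g s t).
Proof.
  intros HU. revert f g. induction n as [|n IH]; intros f g Hf Hg.
  - intros x y Hxy. split; trivial.
    apply continuity_2d_pt_mult; [now apply Hf | now apply Hg].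
  - apply Cn_on_intro with
      (df := fun c s t => pd c f s t * g s t + f s t * pd c g s t); trivial.
    + intros x y Hxy.
      apply continuity_2d_pt_mult; eapply Cn_on_continuity; eassumption.
    + intros c x y Hxy. apply has_pd_mult; eapply Cn_on_has_pd; eassumption.
    + intros c. apply Cn_on_plus; trivial; apply IH; try (now apply Cn_on_pd);
        eapply Cn_on_le; try eassumption; lia.
Qed.

Lemma is_derive_Rpower (b r : R) :
  0 < r -> is_derive (fun t => Rpower t b) r (b * Rpower r (b - 1)).
Proof. intros Hr. apply is_derive_Reals. now apply derivable_pt_lim_power. Qed.

Lemma Cn_on_comp_continuity (n : nat) (U : R * R -> Prop) (h : R -> R) (f : R -> R -> R)
    (x y : R) :
  ex_derive h (f x y) -> Cn_on n U f -> U (x, y) ->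
  continuity_2d_pt (fun s t => h (f s t)) x y.
Proof.
  intros Hh Hf Hxy. apply continuity_1d_2d_pt_comp.
  - apply derivable_continuous_pt. now apply ex_derive_Reals_0.
  - eapply Cn_on_continuity; eassumption.
Qed.

Lemma Cn_on_Rpower (n : nat) (U : R * R -> Prop) (f : R -> R -> R) (b : R) :
  open U -> Cn_on n U f -> (forall x y, U (x, y) -> 0 < f x y) ->
  Cn_on n U (fun s t => Rpower (f s t) b).
Proof.
  intros HU Hf Hpos. revert b Hf. induction n as [|n IH]; intros b Hf.
  - intros x y Hxy. split; trivial.
    eapply Cn_on_comp_continuity with (h := fun r => Rpower r b); try eassumption.
    eexists. apply is_derive_Rpower, Hpos, Hxy.
  - apply Cn_on_intro with
      (df := fun c s t => pd c f s t * (b * Rpower (f s t) (b - 1))); trivial.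
    + intros x y Hxy.
      eapply Cn_on_comp_continuity with (h := fun r => Rpower r b); try eassumption.
      eexists. apply is_derive_Rpower, Hpos, Hxy.
    + intros c x y Hxy. apply has_pd_comp with (h := fun r => Rpower r b).
      * apply is_derive_Rpower, Hpos, Hxy.
      * eapply Cn_on_has_pd; eassumption.
    + intros c. apply Cn_on_mult; trivial; [now apply Cn_on_pd|].
      apply Cn_on_mult; trivial; [now apply Cn_on_const|].
      apply IH. eapply Cn_on_le; try eassumption. lia.
Qed.

Lemma smooth_on_ext (U : R * R -> Prop) (f g : R -> R -> R) :
  open U -> (forall x y, U (x, y) -> f x y = g x y) -> smooth_on U f -> smooth_on U g.
Proof. intros HU Hfg Hf n. apply Cn_on_ext with f; trivial. exact (Hf n). Qed.

Lemma smooth_on_subset (U V : R * R -> Prop) (f : R -> R -> R) :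
  (forall x y, V (x, y) -> U (x, y)) -> smooth_on U f -> smooth_on V f.
Proof. intros HVU Hf n x y Hxy. now apply Hf, HVU. Qed.

Lemma smooth_on_continuity (U : R * R -> Prop) (f : R -> R -> R) (x y : R) :
  smooth_on U f -> U (x, y) -> continuity_2d_pt f x y.
Proof. intros Hf Hxy. exact (Cn_on_continuity 0 U f x y (Hf 0%nat) Hxy). Qed.

Lemma smooth_on_has_pd (U : R * R -> Prop) (f : R -> R -> R) (c : coord) (x y : R) :
  smooth_on U f -> U (x, y) -> has_pd c f x y (pd c f x y).
Proof. intros Hf Hxy. exact (Cn_on_has_pd 0 U f c x y (Hf 1%nat) Hxy). Qed.

Lemma smooth_on_pd (U : R * R -> Prop) (f : R -> R -> R) (c : coord) :
  smooth_on U f -> smooth_on U (pd c f).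
Proof. intros Hf n. exact (Cn_on_pd n U f c (Hf (S n))). Qed.

Lemma smooth_on_intro (U : R * R -> Prop) (f : R -> R -> R)
    (df : coord -> R -> R -> R) :
  open U -> (forall x y, U (x, y) -> continuity_2d_pt f x y) ->
  (forall c x y, U (x, y) -> has_pd c f x y (df c x y)) ->
  (forall c, smooth_on U (df c)) -> smooth_on U f.
Proof.
  intros HU Hc Hd Hs n. apply Cn_on_le with (S n); [lia|].
  apply Cn_on_intro with df; trivial. intros c. exact (Hs c n).
Qed.

Lemma smooth_on_const (U : R * R -> Prop) (r : R) :
  open U -> smooth_on U (fun _ _ => r).
Proof. intros HU n. now apply Cn_on_const. Qed.

Lemma smooth_on_X1 (U : R * R -> Prop) : open U -> smooth_on U (fun s _ => s).
Proof.
  intros HU. apply smooth_on_intro with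
    (df := fun c _ _ => match c with X1 => 1 | X2 => 0 end); trivial.
  - intros. apply continuity_2d_pt_id1.
  - intros [|] x y _; [exact (is_derive_id x) | exact (is_derive_const x y)].
  - intros c. now apply smooth_on_const.
Qed.

Lemma smooth_on_X2 (U : R * R -> Prop) : open U -> smooth_on U (fun _ t => t).
Proof.
  intros HU. apply smooth_on_intro with
    (df := fun c _ _ => match c with X1 => 0 | X2 => 1 end); trivial.
  - intros. apply continuity_2d_pt_id2.
  - intros [|] x y _; [exact (is_derive_const y x) | exact (is_derive_id y)].
  - intros c. now apply smooth_on_const.
Qed.

Lemma smooth_on_plus (U : R * R -> Prop) (f g : R -> R -> R) :
  open U -> smooth_on U f -> smooth_on U g -> smooth_on U (fun s t => f s t + g s t).
Proof. intros HU Hf Hg n. apply Cn_on_plus; trivial; [exact (Hf n) | exact (Hg n)]. Qed.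

Lemma smooth_on_mult (U : R * R -> Prop) (f g : R -> R -> R) :
  open U -> smooth_on U f -> smooth_on U g -> smooth_on U (fun s t => f s t * g s t).
Proof. intros HU Hf Hg n. apply Cn_on_mult; trivial; [exact (Hf n) | exact (Hg n)]. Qed.

Lemma smooth_on_Rpower (U : R * R -> Prop) (f : R -> R -> R) (b : R) :
  open U -> smooth_on U f -> (forall x y, U (x, y) -> 0 < f x y) ->
  smooth_on U (fun s t => Rpower (f s t) b).
Proof. intros HU Hf Hpos n. apply Cn_on_Rpower; trivial. exact (Hf n). Qed.

(** Real powers are closed under differentiation up to constants, while the
    logarithm leaves its own class: its derivatives are powers, already known to
    be smooth. *)
Lemma smooth_on_ln (U : R * R -> Prop) (f : R -> R -> R) :
  open U -> smooth_on U f -> (forall x y, U (x, y) -> 0 < f x y) ->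
  smooth_on U (fun s t => ln (f s t)).
Proof.
  intros HU Hf Hpos.
  apply smooth_on_intro with
    (df := fun c s t => pd c f s t * Rpower (f s t) (-1)); trivial.
  - intros x y Hxy.
    eapply Cn_on_comp_continuity with (1 := ex_intro _ _ (is_derive_ln _ (Hpos x y Hxy)));
      [exact (Hf 0%nat) | exact Hxy].
  - intros c x y Hxy. apply has_pd_comp.
    + change (-1) with (-(1)). rewrite Rpower_Ropp, Rpower_1 by now apply Hpos.
      now apply is_derive_ln, Hpos.
    + now apply smooth_on_has_pd with U.
  - intros c. apply smooth_on_mult; trivial; [now apply smooth_on_pd|].
    now apply smooth_on_Rpower.
Qed.

Lemma pd_comm (U : R * R -> Prop) (f : R -> R -> R) (x y : R) :
  open U -> smooth_on U f -> U (x, y) -> pd X2 (pd X1 f) x y = pd X1 (pd X2 f) x y.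
Proof.
  intros HU Hf Hxy. symmetry. apply Schwarz.
  - apply open_locally_2d_imp with U; trivial. intros s t Hst.
    repeat split; eexists.
    + exact (smooth_on_has_pd U f X1 s t Hf Hst).
    + exact (smooth_on_has_pd U f X2 s t Hf Hst).
    + exact (smooth_on_has_pd U _ X1 s t (smooth_on_pd U f X2 Hf) Hst).
    + exact (smooth_on_has_pd U _ X2 s t (smooth_on_pd U f X1 Hf) Hst).
  - exact (smooth_on_continuity U _ x y (smooth_on_pd _ _ X1 (smooth_on_pd U f X2 Hf)) Hxy).
  - exact (smooth_on_continuity U _ x y (smooth_on_pd _ _ X2 (smooth_on_pd U f X1 Hf)) Hxy).
Qed.

(** * Differential polynomials *)

Definition jet (f : R -> R -> R) (k l : nat) : R -> R -> R :=
  Nat.iter k (pd X1) (Nat.iter l (pd X2) f).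

Lemma smooth_on_jet (U : R * R -> Prop) (f : R -> R -> R) (k l : nat) :
  smooth_on U f -> smooth_on U (jet f k l).
Proof.
  intros Hf. induction k as [|k IHk].
  - induction l as [|l IHl]; [exact Hf|]. exact (smooth_on_pd U _ X2 IHl).
  - exact (smooth_on_pd U _ X1 IHk).
Qed.

Lemma pd_X2_jet (U : R * R -> Prop) (f : R -> R -> R) (k l : nat) (x y : R) :
  open U -> smooth_on U f -> U (x, y) ->
  pd X2 (jet f k l) x y = jet f k (S l) x y.
Proof.
  intros HU Hf. revert x y. induction k as [|k IHk]; intros x y Hxy; [reflexivity|].
  change (jet f (S k) l) with (pd X1 (jet f k l)).
  rewrite (pd_comm U) by (trivial; now apply smooth_on_jet).
  exact (pd_ext_on U X1 _ _ HU IHk x y Hxy).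
Qed.

(* Simplification of [ev] must stop at jets: unfolded iterated derivatives are
   no longer recognized as the same indeterminate. *)
Local Opaque jet.

(** Besides the potential u there is one further unknown function, to which the
    Laplacian is applied. *)
Inductive symbol : Set := Potential | Test.

(** Constant-coefficient polynomials in the partial derivatives of two functions;
    [Jet s k l] stands for k derivatives in x and l in y. They form a ring closed
    under [der], so that derivatives of geometric quantities are computed by
    reduction. *)
Inductive dpoly : Type :=
  | Cst (r : R)
  | Jet (s : symbol) (k l : nat)
  | Add (P Q : dpoly)
  | Mul (P Q : dpoly).

Definition interp (u f : R -> R -> R) (s : symbol) : R -> R -> R :=
  match s with Potential => u | Test => f end.

Fixpoint ev (u f : R -> R -> R) (P : dpoly) (x y : R) : R :=
  match P with
  | Cst r => r
  | Jet s k l => jet (interp u f s) k l x y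
  | Add P Q => ev u f P x y + ev u f Q x y
  | Mul P Q => ev u f P x y * ev u f Q x y
  end.

Fixpoint der (c : coord) (P : dpoly) : dpoly :=
  match P with
  | Cst _ => Cst 0
  | Jet s k l => match c with X1 => Jet s (S k) l | X2 => Jet s k (S l) end
  | Add P Q => Add (der c P) (der c Q)
  | Mul P Q => Add (Mul (der c P) Q) (Mul P (der c Q))
  end.

Lemma has_pd_ev (U : R * R -> Prop) (u f : R -> R -> R) (P : dpoly) (c : coord) (x y : R) :
  open U -> smooth_on U u -> smooth_on U f -> U (x, y) ->
  has_pd c (ev u f P) x y (ev u f (der c P) x y).
Proof.
  intros HU Hu Hf Hxy. induction P as [r|s k l|P IHP Q IHQ|P IHP Q IHQ].
  - apply has_pd_const.
  - assert (Hs : smooth_on U (interp u f s)) by now destruct s.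
    pose proof (smooth_on_has_pd U _ c x y (smooth_on_jet U _ k l Hs) Hxy) as H.
    destruct c; [exact H|]. rewrite (pd_X2_jet U) in H by trivial. exact H.
  - now apply has_pd_plus.
  - now apply has_pd_mult.
Qed.

(** A geometric quantity known to be a differential polynomial on an open set can
    be differentiated formally. *)
Lemma pd_ev (U : R * R -> Prop) (u f v : R -> R -> R) (P : dpoly) (c : coord) :
  open U -> smooth_on U u -> smooth_on U f ->
  (forall x y, U (x, y) -> v x y = ev u f P x y) ->
  forall x y, U (x, y) -> pd c v x y = ev u f (der c P) x y.
Proof.
  intros HU Hu Hf Hv x y Hxy. rewrite (pd_ext_on U c v (ev u f P)) by trivial.
  apply has_pd_unique. now apply has_pd_ev with U.
Qed.

Lemma ev_der_eq (U : R * R -> Prop) (u f : R -> R -> R) (P Q : dpoly) (c : coord) :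
  open U -> smooth_on U u -> smooth_on U f ->
  (forall x y, U (x, y) -> ev u f P x y = ev u f Q x y) ->
  forall x y, U (x, y) -> ev u f (der c P) x y = ev u f (der c Q) x y.
Proof.
  intros HU Hu Hf HPQ x y Hxy.
  rewrite <- (pd_ev U u f (ev u f P) P c) by trivial.
  now apply (pd_ev U u f).
Qed.

Lemma smooth_on_ev (U : R * R -> Prop) (u f : R -> R -> R) (P : dpoly) :
  open U -> smooth_on U u -> smooth_on U f -> smooth_on U (ev u f P).
Proof.
  intros HU Hu Hf. induction P as [r|s k l|P IHP Q IHQ|P IHP Q IHQ].
  - exact (smooth_on_const U r HU).
  - apply smooth_on_jet. now destruct s.
  - exact (smooth_on_plus U _ _ HU IHP IHQ).
  - exact (smooth_on_mult U _ _ HU IHP IHQ).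
Qed.

(** * The Hessian metric of a solution of the Monge-Ampere equation *)

Definition metricP (i j : coord) : dpoly :=
  der i (der j (Jet Potential 0 0)).

(** The adjugate, which is the inverse metric because the determinant is 1. *)
Definition ginvP (i j : coord) : dpoly :=
  match i, j with
  | X1, X1 => metricP X2 X2
  | X2, X2 => metricP X1 X1
  | _, _ => Mul (Cst (-1)) (metricP X1 X2)
  end.

Definition sumP (F : coord -> dpoly) : dpoly := Add (F X1) (F X2).

(** For a Hessian metric d_l g_ij is totally symmetric, so two of the three terms
    of the general formula cancel. *)
Definition ChristoffelP (k i j : coord) : dpoly :=
  Mul (Cst (/ 2)) (sumP (fun l => Mul (ginvP k l) (der l (metricP i j)))).

(** The curvature is the contraction with the inverse metric of the Hessian
    covariant of the binary cubic form d^3 u, up to a factor. For det = 1 there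
    are expressions with fewer terms but with a denominator; this one is
    polynomial. *)
Definition curvP : dpoly :=
  let a := metricP X1 X1 in
  let b := metricP X1 X2 in
  let c := metricP X2 X2 in
  let T0 := der X1 a in
  let T1 := der X2 a in
  let T2 := der X1 c in
  let T3 := der X2 c in
  let neg P := Mul (Cst (-1)) P in
  Mul (Cst (/ 2))
   (Add (Mul c (Add (Mul T1 T1) (neg (Mul T0 T2))))
   (Add (Mul b (Add (Mul T0 T3) (neg (Mul T1 T2))))
        (Mul a (Add (Mul T2 T2) (neg (Mul T1 T3)))))).

Definition detP : dpoly :=
  Add (Mul (metricP X1 X1) (metricP X2 X2))
      (Mul (Cst (-1)) (Mul (metricP X1 X2) (metricP X1 X2))).

Definition MongeAmpere_solution (U : R * R -> Prop) (u : R -> R -> R) : Prop :=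
  open U /\ smooth_on U u /\
  (forall x y, U (x, y) -> pos_def (Hess u) x y) /\
  (forall x y, U (x, y) -> det2 (Hess u) x y = 1).

Lemma Hess_ev (U : R * R -> Prop) (u f : R -> R -> R) (i j : coord) (x y : R) :
  open U -> smooth_on U u -> U (x, y) -> Hess u i j x y = ev u f (metricP i j) x y.
Proof.
  intros HU Hu Hxy. destruct i, j; try reflexivity.
  exact (pd_comm U u x y HU Hu Hxy).
Qed.

Lemma det_ev (U : R * R -> Prop) (u f : R -> R -> R) (x y : R) :
  MongeAmpere_solution U u -> U (x, y) -> ev u f detP x y = ev u f (Cst 1) x y.
Proof.
  intros (HU & Hu & _ & Hdet) Hxy. simpl ev at 2. rewrite <- (Hdet x y Hxy).
  unfold det2. rewrite !(Hess_ev U u f) by trivial. simpl. ring.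
Qed.

Lemma ev_der_det (U : R * R -> Prop) (u f : R -> R -> R) (c : coord) (x y : R) :
  MongeAmpere_solution U u -> smooth_on U f -> U (x, y) -> ev u f (der c detP) x y = 0.
Proof.
  intros Hsol Hf Hxy. pose proof Hsol as (HU & Hu & _).
  exact (ev_der_eq U u f detP (Cst 1) c HU Hu Hf
           (fun s t => det_ev U u f s t Hsol) x y Hxy).
Qed.

Lemma ginv_ev (U : R * R -> Prop) (u f : R -> R -> R) (i j : coord) (x y : R) :
  MongeAmpere_solution U u -> U (x, y) -> ginv (Hess u) i j x y = ev u f (ginvP i j) x y.
Proof.
  intros (HU & Hu & _ & Hdet) Hxy. unfold ginv. rewrite Hdet by trivial.
  destruct i, j; rewrite (Hess_ev U u f) by trivial; simpl; field.
Qed.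

Lemma pd_Hess_ev (U : R * R -> Prop) (u f : R -> R -> R) (c i j : coord) (x y : R) :
  open U -> smooth_on U u -> smooth_on U f -> U (x, y) ->
  pd c (Hess u i j) x y = ev u f (der c (metricP i j)) x y.
Proof.
  intros HU Hu Hf. apply pd_ev; trivial.
  intros. now apply Hess_ev with U.
Qed.

Lemma Christoffel_ev (U : R * R -> Prop) (u f : R -> R -> R) (k i j : coord) (x y : R) :
  MongeAmpere_solution U u -> smooth_on U f -> U (x, y) ->
  Christoffel (Hess u) k i j x y = ev u f (ChristoffelP k i j) x y.
Proof.
  intros Hsol Hf Hxy. pose proof Hsol as (HU & Hu & _).
  unfold Christoffel, sumc.
  rewrite !(pd_Hess_ev U u f), !(ginv_ev U u f) by trivial.
  destruct k, i, j; simpl; ring.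
Qed.

(** The fourth derivatives of u cancel in the curvature. The products of two
    derivatives of the metric contribute twice [curvP], the products of two
    Christoffel symbols contribute minus det (Hess u) times [curvP]. *)
Lemma scalar_curvature_ev (U : R * R -> Prop) (u f : R -> R -> R) (x y : R) :
  MongeAmpere_solution U u -> smooth_on U f -> U (x, y) ->
  scalar_curvature (Hess u) x y = ev u f curvP x y.
Proof.
  intros Hsol Hf Hxy. pose proof Hsol as (HU & Hu & _).
  assert (HG : forall c k i j, pd c (Christoffel (Hess u) k i j) x y =
     ev u f (der c (ChristoffelP k i j)) x y).
  { intros c k i j. apply pd_ev with U; trivial. intros. now apply Christoffel_ev with U. }
  pose proof (det_ev U u f x y Hsol Hxy) as E0.
  unfold scalar_curvature, Ricci, Riemann, sumc.
  rewrite !HG, !(Christoffel_ev U u f), !(ginv_ev U u f) by trivial.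
  apply Rminus_diag_uniq.
  transitivity ((ev u f (Cst 1) x y - ev u f detP x y) * ev u f curvP x y);
    [|rewrite E0; ring].
  clear. simpl. field.
Qed.

Lemma MongeAmpere_solution_subset (U V : R * R -> Prop) (u : R -> R -> R) :
  open V -> (forall x y, V (x, y) -> U (x, y)) -> MongeAmpere_solution U u ->
  MongeAmpere_solution V u.
Proof.
  intros HV HVU (_ & Hu & Hpos & Hdet).
  split; [exact HV|]. split; [now apply smooth_on_subset with U|]. split; auto.
Qed.

Lemma uxx_pos (U : R * R -> Prop) (u f : R -> R -> R) (x y : R) :
  MongeAmpere_solution U u -> U (x, y) -> 0 < ev u f (metricP X1 X1) x y.
Proof.
  intros (HU & Hu & Hpos & _) Hxy.
  assert (H : 0 < sumc (fun i => sumc (fun j => Hess u i j x y *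
    match i with X1 => 1 | X2 => 0 end * match j with X1 => 1 | X2 => 0 end))).
  { apply (Hpos x y Hxy (fun i => match i with X1 => 1 | X2 => 0 end)). exists X1. lra. }
  rewrite <- (Hess_ev U u f) by trivial. unfold sumc in H. lra.
Qed.

(** With a = u_xx the right-hand side is |grad log a|^2 for the metric Hess u,
    written as a sum of squares in the orthogonal frame d_x, a d_y - b d_x. *)
Lemma scalar_curvature_formula (U : R * R -> Prop) (u : R -> R -> R) (x y : R) :
  MongeAmpere_solution U u -> U (x, y) ->
  scalar_curvature (Hess u) x y =
    (pd X1 (Hess u X1 X1) x y ^ 2
     + (Hess u X1 X1 x y * pd X2 (Hess u X1 X1) x y
        - Hess u X1 X2 x y * pd X1 (Hess u X1 X1) x y) ^ 2) / Hess u X1 X1 x y ^ 3.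
Proof.
  intros Hsol Hxy. pose proof Hsol as (HU & Hu & _).
  rewrite (scalar_curvature_ev U u u), !(pd_Hess_ev U u u), !(Hess_ev U u u) by trivial.
  pose proof (uxx_pos U u u x y Hsol Hxy) as Ha.
  pose proof (det_ev U u u x y Hsol Hxy) as E.
  pose proof (ev_der_det U u u X1 x y Hsol Hu Hxy) as Ex.
  pose proof (ev_der_det U u u X2 x y Hsol Hu Hxy) as Ey.
  simpl in *.
  set (a := jet u 2 0 x y) in *. set (b := jet u 1 1 x y) in *.
  set (c := jet u 0 2 x y) in *. set (p := jet u 3 0 x y) in *.
  set (q := jet u 2 1 x y) in *. set (r := jet u 1 2 x y) in *.
  set (s := jet u 0 3 x y) in *. clearbody a b c p q r s.
  assert (Hc : c = (1 + b * b) / a) by (field_simplify_eq; lra).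
  assert (Hr : r = (2 * b * q - p * c) / a) by (field_simplify_eq; lra).
  assert (Hs : s = (2 * b * r - q * c) / a) by (field_simplify_eq; lra).
  rewrite Hs, Hr, Hc. field. lra.
Qed.

Lemma scalar_curvature_nonneg (U : R * R -> Prop) (u : R -> R -> R) (x y : R) :
  MongeAmpere_solution U u -> U (x, y) -> 0 <= scalar_curvature (Hess u) x y.
Proof.
  intros Hsol Hxy. rewrite (scalar_curvature_formula U) by trivial.
  apply Rdiv_le_0_compat.
  - apply Rplus_le_le_0_compat; apply pow2_ge_0.
  - apply pow_lt. exact (uxx_pos U u u x y Hsol Hxy).
Qed.

(** * The differential identity for the scalar curvature *)

Definition gradP (P Q : dpoly) : dpoly :=
  sumP (fun i => sumP (fun j => Mul (ginvP i j) (Mul (der i P) (der j Q)))).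

(** The Laplacian has no first-order term because x and y are harmonic for a
    Hessian metric with determinant 1. *)
Definition lapP (P : dpoly) : dpoly :=
  sumP (fun i => sumP (fun j => Mul (ginvP i j) (der i (der j P)))).

Lemma gradP_nonneg (U : R * R -> Prop) (u f : R -> R -> R) (P : dpoly) (x y : R) :
  MongeAmpere_solution U u -> U (x, y) -> 0 <= ev u f (gradP P P) x y.
Proof.
  intros Hsol Hxy.
  pose proof (uxx_pos U u f x y Hsol Hxy) as Ha.
  pose proof (det_ev U u f x y Hsol Hxy) as E.
  apply Rmult_le_reg_l with (1 := Ha). rewrite Rmult_0_r.
  replace (ev u f (metricP X1 X1) x y * ev u f (gradP P P) x y) with
    (ev u f detP x y * ev u f (der X1 P) x y ^ 2
     + (ev u f (metricP X1 X1) x y * ev u f (der X2 P) x y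
        - ev u f (metricP X1 X2) x y * ev u f (der X1 P) x y) ^ 2).
  - rewrite E. simpl (ev u f (Cst 1) x y).
    apply Rplus_le_le_0_compat; [rewrite Rmult_1_l|]; apply pow2_ge_0.
  - cbn [gradP sumP ev ginvP detP]. ring.
Qed.

(** This is Lap (log R) = 3 R multiplied by R^2, so that it also makes sense at the
    zeros of R. The derivatives of the equation a c - b^2 = 1 up to order three
    leave free the jets with at most one derivative in y, which makes the claim
    an identity of rational functions of eight variables. *)
Lemma curv_Bochner (U : R * R -> Prop) (u f : R -> R -> R) (x y : R) :
  MongeAmpere_solution U u -> smooth_on U f -> U (x, y) ->
  ev u f curvP x y * ev u f (lapP curvP) x y =
  ev u f (gradP curvP curvP) x y + 3 * ev u f curvP x y ^ 3.
Proof.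
  intros Hsol Hf Hxy. pose proof Hsol as (HU & Hu & _).
  pose proof (uxx_pos U u f x y Hsol Hxy) as Ha.
  pose proof (ev_der_det U u f X1) as Dx. pose proof (ev_der_det U u f X2) as Dy.
  assert (D : forall P c d,
      (forall s t, U (s, t) -> ev u f (der c P) s t = ev u f (Cst 0) s t) ->
      forall s t, U (s, t) -> ev u f (der d (der c P)) s t = ev u f (Cst 0) s t).
  { intros P c d HP s t Hst. exact (ev_der_eq U u f _ _ d HU Hu Hf HP s t Hst). }
  assert (Ex : forall s t, U (s, t) -> ev u f (der X1 detP) s t = ev u f (Cst 0) s t)
    by (intros; now apply Dx).
  assert (Ey : forall s t, U (s, t) -> ev u f (der X2 detP) s t = ev u f (Cst 0) s t)
    by (intros; now apply Dy).
  pose proof (D _ _ X1 Ex) as Exx.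
  pose proof (D _ _ X1 Ey) as Exy.
  pose proof (D _ _ X2 Ey) as Eyy.
  pose proof (D _ _ X1 Exx x y Hxy) as Exxx.
  pose proof (D _ _ X1 Exy x y Hxy) as Exxy.
  pose proof (D _ _ X1 Eyy x y Hxy) as Exyy.
  pose proof (D _ _ X2 Eyy x y Hxy) as Eyyy.
  pose proof (det_ev U u f x y Hsol Hxy) as E.
  specialize (Ex x y Hxy). specialize (Ey x y Hxy).
  specialize (Exx x y Hxy). specialize (Exy x y Hxy). specialize (Eyy x y Hxy).
  clear Dx Dy D. simpl in *.
  set (a := jet u 2 0 x y) in *. set (b := jet u 1 1 x y) in *.
  set (c := jet u 0 2 x y) in *.
  set (p := jet u 3 0 x y) in *. set (q := jet u 2 1 x y) in *.
  set (r := jet u 1 2 x y) in *. set (s := jet u 0 3 x y) in *.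
  set (Q0 := jet u 4 0 x y) in *. set (Q1 := jet u 3 1 x y) in *.
  set (Q2 := jet u 2 2 x y) in *. set (Q3 := jet u 1 3 x y) in *.
  set (Q4 := jet u 0 4 x y) in *.
  set (P0 := jet u 5 0 x y) in *. set (P1 := jet u 4 1 x y) in *.
  set (P2 := jet u 3 2 x y) in *. set (P3 := jet u 2 3 x y) in *.
  set (P4 := jet u 1 4 x y) in *. set (P5 := jet u 0 5 x y) in *.
  clearbody a b c p q r s Q0 Q1 Q2 Q3 Q4 P0 P1 P2 P3 P4 P5.
  (* In every derivative of a c - b^2 = 1 the jet with most derivatives in y has
     coefficient a, so each equation is solved for that jet. *)
  assert (Hc : c = (1 + b * b) / a) by (field_simplify_eq; lra).
  assert (Hr : r = (2 * b * q - p * c) / a) by (field_simplify_eq; lra).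
  assert (Hs : s = (2 * b * r - q * c) / a) by (field_simplify_eq; lra).
  assert (HQ2 : Q2 = (2 * b * Q1 - c * Q0 + 2 * (q * q - p * r)) / a)
    by (field_simplify_eq; lra).
  assert (HQ3 : Q3 = (2 * b * Q2 - c * Q1 + q * r - p * s) / a)
    by (field_simplify_eq; lra).
  assert (HQ4 : Q4 = (2 * b * Q3 - c * Q2 + 2 * (r * r - q * s)) / a)
    by (field_simplify_eq; lra).
  assert (HP2 : P2 = (2 * b * P1 - c * P0 + 6 * q * Q1 - 3 * r * Q0 - 3 * p * Q2) / a)
    by (field_simplify_eq; lra).
  assert (HP3 : P3 = (2 * b * P2 - c * P1 + 3 * q * Q2 - s * Q0 - 2 * p * Q3) / a)
    by (field_simplify_eq; lra).
  assert (HP4 : P4 = (2 * b * P3 - c * P2 + 3 * r * Q2 - 2 * s * Q1 - p * Q4) / a)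
    by (field_simplify_eq; lra).
  assert (HP5 : P5 = (2 * b * P4 - c * P3 + 6 * r * Q3 - 3 * s * Q2 - 3 * q * Q4) / a)
    by (field_simplify_eq; lra).
  rewrite HP5, HP4, HP3, HP2, HQ4, HQ3, HQ2, Hs, Hr, Hc. field. lra.
Qed.

(** Both first-order contributions vanish: d_i g^ij = 0 by symmetry of the third
    derivatives, and the contracted Christoffel symbols are half the logarithmic
    derivative of the determinant. *)
Lemma LaplaceBeltrami_ev (U : R * R -> Prop) (u f : R -> R -> R) (x y : R) :
  MongeAmpere_solution U u -> smooth_on U f -> U (x, y) ->
  LaplaceBeltrami (Hess u) f x y = ev u f (lapP (Jet Test 0 0)) x y.
Proof.
  intros Hsol Hf Hxy. pose proof Hsol as (HU & Hu & _).
  assert (HG : forall i s t, U (s, t) -> gradient (Hess u) f i s t =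
      ev u f (sumP (fun j => Mul (ginvP i j) (der j (Jet Test 0 0)))) s t).
  { intros i s t Hst. unfold gradient, sumc.
    rewrite !(ginv_ev U u f), !(pd_ev U u f f (Jet Test 0 0)) by trivial.
    reflexivity. }
  unfold LaplaceBeltrami, divergence, sumc.
  rewrite !(pd_ev U u f _ _ _ HU Hu Hf (HG _) x y Hxy).
  rewrite !HG, !(Christoffel_ev U u f) by trivial.
  pose proof (ev_der_det U u f X1 x y Hsol Hf Hxy) as Ex.
  pose proof (ev_der_det U u f X2 x y Hsol Hf Hxy) as Ey.
  apply Rminus_diag_uniq.
  transitivity (/ 2 * (ev u f (der X1 detP) x y *
      ev u f (sumP (fun j => Mul (ginvP X1 j) (der j (Jet Test 0 0)))) x y
    + ev u f (der X2 detP) x y *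
      ev u f (sumP (fun j => Mul (ginvP X2 j) (der j (Jet Test 0 0)))) x y)).
  - clear. simpl. field.
  - rewrite Ex, Ey. simpl. ring.
Qed.

(** The hypothesis is the polynomial form of Q = P^alpha up to a constant factor.
    Differentiating this relation once more gives the second derivatives of Q
    without differentiating real powers twice. *)
Lemma lap_of_power_relation (U : R * R -> Prop) (u f : R -> R -> R) (P Q : dpoly)
    (alpha x y : R) :
  open U -> smooth_on U u -> smooth_on U f ->
  (forall c s t, U (s, t) ->
     ev u f (Mul P (der c Q)) s t = ev u f (Mul (Cst alpha) (Mul Q (der c P))) s t) ->
  U (x, y) ->
  ev u f P x y ^ 2 * ev u f (lapP Q) x y =
  alpha * ev u f Q x y *
    (ev u f P x y * ev u f (lapP P) x y + (alpha - 1) * ev u f (gradP P P) x y).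
Proof.
  intros HU Hu Hf HPQ Hxy.
  assert (H2 : forall c d, ev u f P x y ^ 2 * ev u f (der d (der c Q)) x y =
    alpha * ev u f Q x y * (ev u f P x y * ev u f (der d (der c P)) x y
      + (alpha - 1) * (ev u f (der d P) x y * ev u f (der c P) x y))).
  { intros c d.
    pose proof (ev_der_eq U u f _ _ d HU Hu Hf (HPQ c) x y Hxy) as Hcd.
    pose proof (HPQ c x y Hxy) as Hc. pose proof (HPQ d x y Hxy) as Hd.
    cbn [ev der] in Hc, Hd, Hcd.
    transitivity (ev u f P x y *
        (ev u f (der d P) x y * ev u f (der c Q) x y
         + ev u f P x y * ev u f (der d (der c Q)) x y)
      - ev u f (der d P) x y * (ev u f P x y * ev u f (der c Q) x y)); [ring|].
    rewrite Hcd, Hc.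
    transitivity (alpha * ev u f (der c P) x y * (ev u f P x y * ev u f (der d Q) x y)
      + alpha * ev u f P x y * ev u f Q x y * ev u f (der d (der c P)) x y
      - alpha * ev u f Q x y * ev u f (der c P) x y * ev u f (der d P) x y); [ring|].
    rewrite Hd. ring. }
  cbn [lapP gradP sumP ev].
  transitivity (
      ev u f (ginvP X1 X1) x y * (ev u f P x y ^ 2 * ev u f (der X1 (der X1 Q)) x y)
    + ev u f (ginvP X1 X2) x y * (ev u f P x y ^ 2 * ev u f (der X1 (der X2 Q)) x y)
    + ev u f (ginvP X2 X1) x y * (ev u f P x y ^ 2 * ev u f (der X2 (der X1 Q)) x y)
    + ev u f (ginvP X2 X2) x y * (ev u f P x y ^ 2 * ev u f (der X2 (der X2 Q)) x y));
    [ring|].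
  rewrite !H2. ring.
Qed.

Lemma LaplaceBeltrami_power (U : R * R -> Prop) (u : R -> R -> R) (alpha x y : R) :
  MongeAmpere_solution U u -> (forall s t, U (s, t) -> 0 < ev u u curvP s t) -> U (x, y) ->
  let K := ev u u curvP in
  let h := fun s t => Rpower (K s t) alpha in
  smooth_on U h /\
  LaplaceBeltrami (Hess u) h x y =
    3 * alpha * (h x y * K x y)
    + alpha ^ 2 * h x y * ev u u (gradP curvP curvP) x y / K x y ^ 2.
Proof.
  intros Hsol HK Hxy K h. pose proof Hsol as (HU & Hu & _).
  assert (HsK : smooth_on U K) by now apply smooth_on_ev.
  assert (Hsh : smooth_on U h) by now apply smooth_on_Rpower.
  split; [exact Hsh|].
  rewrite (LaplaceBeltrami_ev U) by trivial.
  assert (Hrel : forall c s t, U (s, t) ->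
     ev u h (Mul curvP (der c (Jet Test 0 0))) s t =
     ev u h (Mul (Cst alpha) (Mul (Jet Test 0 0) (der c curvP))) s t).
  { intros c s t Hst. cbn [ev].
    rewrite <- (pd_ev U u h h (Jet Test 0 0) c HU Hu Hsh (fun _ _ _ => eq_refl) s t Hst).
    change (ev u h curvP s t) with (K s t).
    change (ev u h (Jet Test 0 0) s t) with (h s t).
    rewrite <- (pd_ev U u h K curvP c HU Hu Hsh (fun _ _ _ => eq_refl) s t Hst).
    assert (E : pd c h s t = pd c K s t * (alpha * Rpower (K s t) (alpha - 1))).
    { apply has_pd_unique.
      apply has_pd_comp with (h := fun r => Rpower r alpha).
      - now apply is_derive_Rpower, HK.
      - now apply smooth_on_has_pd with U. }
    rewrite E. change (jet (interp u h Test) 0 0 s t) with (h s t).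
    assert (Eh : h s t = K s t * Rpower (K s t) (alpha - 1)).
    { rewrite <- (Rpower_1 (K s t)) at 1 by now apply HK.
      rewrite <- Rpower_plus. unfold h. f_equal. ring. }
    rewrite Eh. ring. }
  pose proof (lap_of_power_relation U u h _ _ alpha x y HU Hu Hsh Hrel Hxy) as H.
  pose proof (curv_Bochner U u h x y Hsol Hsh Hxy) as HB.
  rewrite HB in H.
  change (ev u h curvP x y) with (K x y) in H.
  change (ev u h (Jet Test 0 0) x y) with (h x y) in H.
  change (ev u h (gradP curvP curvP) x y) with (ev u u (gradP curvP curvP) x y) in H.
  specialize (HK x y Hxy). fold K in HK.
  apply Rmult_eq_reg_l with (K x y ^ 2); [|apply pow_nonzero; lra].
  rewrite H. field. lra.
Qed.

(** * The barrier inequality *)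

Lemma LaplaceBeltrami_ext (U : R * R -> Prop) (g : tensor2) (v w : R -> R -> R) (x y : R) :
  open U -> U (x, y) -> (forall s t, U (s, t) -> v s t = w s t) ->
  LaplaceBeltrami g v x y = LaplaceBeltrami g w x y.
Proof.
  intros HU Hxy Hvw.
  assert (HG : forall i s t, U (s, t) -> gradient g v i s t = gradient g w i s t).
  { intros i s t Hst. unfold gradient, sumc.
    now rewrite !(pd_ext_on U _ v w HU Hvw s t Hst). }
  unfold LaplaceBeltrami, divergence, sumc.
  rewrite !(pd_ext_on U _ _ _ HU (HG _) x y Hxy), !HG by trivial. reflexivity.
Qed.

Lemma LaplaceBeltrami_const (g : tensor2) (r x y : R) :
  LaplaceBeltrami g (fun _ _ => r) x y = 0.
Proof.
  assert (HG : forall i s t, gradient g (fun _ _ => r) i s t = 0).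
  { intros i s t. unfold gradient, sumc.
    rewrite !(has_pd_unique _ _ _ _ _ (has_pd_const _ r s t)). ring. }
  assert (HD : forall i, pd i (gradient g (fun _ _ => r) i) x y = 0).
  { intros i. rewrite (pd_ext_loc i _ (fun _ _ => 0)).
    - apply has_pd_unique, has_pd_const.
    - now apply locally_2d_forall. }
  unfold LaplaceBeltrami, divergence, sumc. rewrite !HD, !HG. ring.
Qed.

Lemma rpow_continuity (a r : R) : 0 < a -> continuity_pt (fun t => rpow t a) r.
Proof.
  intros Ha. destruct (Rtotal_order r 0) as [Hr|[Hr|Hr]].
  - apply continuity_pt_ext_loc with (fun _ => 0).
    + generalize (open_lt 0 r Hr). apply filter_imp. intros t Ht.
      unfold rpow. destruct (Rlt_dec 0 t); lra.
    + apply continuity_pt_const. now intros s t.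
  - subst r. intros eps Heps.
    exists (Rpower eps (/ a)). split; [apply exp_pos|].
    intros t [_ Ht]. simpl in *. unfold R_dist in *.
    rewrite Rminus_0_r in Ht.
    unfold rpow. destruct (Rlt_dec 0 0) as [H|_]; [lra|].
    rewrite Rminus_0_r. destruct (Rlt_dec 0 t) as [H|_].
    + rewrite (Rabs_pos_eq t) in Ht by now apply Rlt_le.
      rewrite Rabs_pos_eq by apply Rlt_le, exp_pos.
      replace eps with (Rpower (Rpower eps (/ a)) a).
      * apply Rlt_Rpower_l; trivial. split; trivial.
      * rewrite Rpower_mult, Rinv_l, Rpower_1; trivial. lra.
    + now rewrite Rabs_R0.
  - apply continuity_pt_ext_loc with (fun t => Rpower t a).
    + generalize (open_gt 0 r Hr). apply filter_imp. intros t Ht.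
      unfold rpow. destruct (Rlt_dec 0 t); [trivial|lra].
    + apply derivable_continuous_pt, ex_derive_Reals_0.
      eexists. now apply is_derive_Rpower.
Qed.

(** On the open set R > 0 the function R^alpha is smooth and serves as its own
    barrier; at a zero of R the barrier is the constant 0. *)
Lemma scalar_curvature_power_barrier (U : R * R -> Prop) (u : R -> R -> R) (alpha : R) :
  MongeAmpere_solution U u -> 0 < alpha ->
  barrier_ge (Hess u) U
    (fun x y => rpow (scalar_curvature (Hess u) x y) alpha)
    (fun x y => 3 * alpha * rpow (scalar_curvature (Hess u) x y) (alpha + 1)).
Proof.
  intros Hsol Halpha. pose proof Hsol as (HU & Hu & _).
  assert (HK : forall x y, U (x, y) -> scalar_curvature (Hess u) x y = ev u u curvP x y).
  { intros x y Hxy. now apply (scalar_curvature_ev U). }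
  assert (Hcont : forall x y, U (x, y) -> continuity_2d_pt (ev u u curvP) x y).
  { intros x y Hxy. apply smooth_on_continuity with U; trivial. now apply smooth_on_ev. }
  assert (Hpow : forall a, 0 < a ->
      continuous_on_2d U (fun x y => rpow (scalar_curvature (Hess u) x y) a)).
  { intros a Ha x y Hxy.
    apply continuity_2d_pt_ext_loc with (fun s t => rpow (ev u u curvP s t) a).
    - apply open_locally_2d_imp with U; trivial. intros s t Hst. now rewrite HK.
    - apply continuity_1d_2d_pt_comp with (f := fun r => rpow r a).
      + now apply rpow_continuity.
      + now apply Hcont. }
  split; [now apply Hpow|]. split.
  { intros x y Hxy. apply continuity_2d_pt_mult; [apply continuity_2d_pt_const|].
    apply Hpow; trivial. lra. }
  intros x y Hxy eps Heps. rewrite HK by trivial.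
  destruct (Rlt_dec 0 (ev u u curvP x y)) as [Hpos|Hpos].
  - set (V := fun z : R * R => U z /\ 0 < ev u u curvP (fst z) (snd z)).
    assert (HV : open V) by now apply open_and_pos.
    assert (HVU : forall s t, V (s, t) -> U (s, t)) by (intros s t [Hst _]; exact Hst).
    assert (HVpos : forall s t, V (s, t) -> 0 < ev u u curvP s t)
      by (intros s t [_ Hst]; exact Hst).
    assert (HVxy : V (x, y)) by now split.
    assert (HVsol : MongeAmpere_solution V u) by now apply MongeAmpere_solution_subset with U.
    destruct (LaplaceBeltrami_power V u alpha x y HVsol HVpos HVxy) as [Hsm HL].
    cbv zeta in HL.
    exists (fun s t => Rpower (ev u u curvP s t) alpha).
    repeat split.
    + apply open_locally_2d_imp with V; trivial. intros s t. apply Hsm.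
    + apply open_locally_2d_imp with V; trivial. intros s t Hst.
      rewrite HK by now apply HVU.
      unfold rpow. destruct (Rlt_dec 0 (ev u u curvP s t)) as [_|H]; [lra|].
      now specialize (HVpos s t Hst).
    + unfold rpow. destruct (Rlt_dec 0 (ev u u curvP x y)); [trivial|lra].
    + rewrite HL. unfold rpow. destruct (Rlt_dec 0 (ev u u curvP x y)); [|lra].
      rewrite Rpower_plus, Rpower_1 by trivial.
      assert (0 <= alpha ^ 2 * Rpower (ev u u curvP x y) alpha
                   * ev u u (gradP curvP curvP) x y / ev u u curvP x y ^ 2).
      { apply Rdiv_le_0_compat; [|now apply pow_lt].
        apply Rmult_le_pos; [apply Rmult_le_pos|].
        - apply pow2_ge_0.
        - apply Rlt_le, exp_pos.
        - now apply gradP_nonneg with U. }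
      lra.
  - exists (fun _ _ => 0). repeat split.
    + apply locally_2d_forall. intros s t.
      apply (Cn_on_const 2 (fun _ => True)); [exact open_true|trivial].
    + apply locally_2d_forall. intros s t. unfold rpow.
      destruct (Rlt_dec 0 _); [apply Rlt_le, exp_pos | lra].
    + unfold rpow. destruct (Rlt_dec 0 (ev u u curvP x y)); lra.
    + rewrite LaplaceBeltrami_const. unfold rpow.
      destruct (Rlt_dec 0 (ev u u curvP x y)); lra.
Qed.

Lemma LaplaceBeltrami_power_critical (U : R * R -> Prop) (u : R -> R -> R) (alpha x y : R) :
  MongeAmpere_solution U u -> U (x, y) ->
  (forall s t, U (s, t) -> 0 < scalar_curvature (Hess u) s t) ->
  (forall c, pd c (scalar_curvature (Hess u)) x y = 0) ->
  LaplaceBeltrami (Hess u) (fun s t => rpow (scalar_curvature (Hess u) s t) alpha) x y =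
  3 * alpha * rpow (scalar_curvature (Hess u) x y) (alpha + 1).
Proof.
  intros Hsol Hxy Hpos Hcrit. pose proof Hsol as (HU & Hu & _).
  assert (HK : forall s t, U (s, t) -> scalar_curvature (Hess u) s t = ev u u curvP s t).
  { intros s t Hst. now apply (scalar_curvature_ev U). }
  assert (HKpos : forall s t, U (s, t) -> 0 < ev u u curvP s t).
  { intros s t Hst. rewrite <- HK by trivial. now apply Hpos. }
  assert (Hgrad : ev u u (gradP curvP curvP) x y = 0).
  { cbn [gradP sumP ev].
    rewrite <- !(pd_ev U u u _ curvP _ HU Hu Hu HK x y Hxy), !Hcrit. ring. }
  destruct (LaplaceBeltrami_power U u alpha x y Hsol HKpos Hxy) as [_ HL].
  cbv zeta in HL. rewrite Hgrad in HL.
  rewrite (LaplaceBeltrami_ext U _ _ (fun s t => Rpower (ev u u curvP s t) alpha)); trivial.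
  - rewrite HL, HK by trivial. specialize (HKpos x y Hxy). unfold rpow.
    destruct (Rlt_dec 0 (ev u u curvP x y)); [|lra].
    rewrite Rpower_plus, Rpower_1 by trivial. field. lra.
  - intros s t Hst. rewrite HK by trivial. specialize (HKpos s t Hst). unfold rpow.
    destruct (Rlt_dec 0 (ev u u curvP s t)); [trivial|lra].
Qed.

(** * A solution whose curvature has critical points *)

Definition rad (x y : R) : R := sqrt (1 - 4 * x ^ 2 * y ^ 2).

Definition model_domain (z : R * R) : Prop :=
  0 < fst z /\ 0 < 1 - 4 * fst z ^ 2 * snd z ^ 2.

(** The partial Legendre transform f(p, y) = x p - u of this solution, p = u_x, is
    the harmonic function - log (p^2 + y^2) / 2; the equation x = f_p is quadratic
    in p and its root p = - (1 + s) / (2 x) is the one with f_pp > 0. *)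
Definition model (x y : R) : R := (ln (1 + rad x y) - rad x y) / 2 - ln x.

Definition model_uxx (x y : R) : R := (1 + rad x y) / (2 * x ^ 2 * rad x y).
Definition model_uxy (x y : R) : R := 2 * x * y / rad x y.
Definition model_uyy (x y : R) : R := 2 * x ^ 2 / (rad x y * (1 + rad x y)).

Lemma rad_spec (x y : R) :
  model_domain (x, y) -> 0 < x /\ 0 < rad x y /\ rad x y ^ 2 = 1 - 4 * x ^ 2 * y ^ 2.
Proof.
  intros [Hx Hy]. simpl fst in *. simpl snd in *. split; [exact Hx|].
  split; [now apply sqrt_lt_R0|]. unfold rad. now rewrite pow2_sqrt by lra.
Qed.

Lemma has_pd_rad (c : coord) (x y : R) : model_domain (x, y) ->
  has_pd c rad x y
    match c with X1 => - (4 * x * y ^ 2) / rad x y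
               | X2 => - (4 * x ^ 2 * y) / rad x y end.
Proof.
  intros H. destruct (rad_spec x y H) as (Hx & Hs & _). destruct H as [_ H].
  simpl fst in H. simpl snd in H.
  replace (match c with X1 => _ | X2 => _ end) with
    (match c with X1 => - (8 * x * y ^ 2) | X2 => - (8 * x ^ 2 * y) end * / (2 * rad x y))
    by (destruct c; field; lra).
  apply has_pd_comp with (h := sqrt) (f := fun s t => 1 - 4 * s ^ 2 * t ^ 2).
  - apply is_derive_Reals. now apply derivable_pt_lim_sqrt.
  - destruct c; simpl; auto_derive; trivial; ring.
Qed.

(** Proves a derivative formula for an expression in the coordinates and [rad]:
    after clearing denominators, the two sides differ by a multiple of the
    relation defining [rad]. *)
Ltac derive_rad c H :=
  destruct (rad_spec _ _ H) as (Hx & Hs & E);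
  pose proof (has_pd_rad c _ _ H) as Hd;
  pose proof (has_pd_unique c _ _ _ _ Hd) as Hd';
  cbn [has_pd pd] in Hd, Hd' |- *;
  auto_derive;
  [ repeat split; try (eexists; exact Hd); try lra;
    repeat apply Rmult_integral_contrapositive_currified; lra
  | rewrite Hd';
    field_simplify_eq; [ring [E] | repeat split; lra] ].

Lemma has_pd_model (c : coord) (x y : R) : model_domain (x, y) ->
  has_pd c model x y
    match c with X1 => - (1 + rad x y) / (2 * x)
               | X2 => 2 * x ^ 2 * y / (1 + rad x y) end.
Proof. intros H. unfold model. destruct c; [derive_rad X1 H | derive_rad X2 H]. Qed.

Lemma has_pd_model_ux (c : coord) (x y : R) : model_domain (x, y) ->
  has_pd c (fun s t => - (1 + rad s t) / (2 * s)) x y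
    match c with X1 => model_uxx x y | X2 => model_uxy x y end.
Proof.
  intros H. unfold model_uxx, model_uxy.
  destruct c; [derive_rad X1 H | derive_rad X2 H].
Qed.

Lemma has_pd_model_uy (c : coord) (x y : R) : model_domain (x, y) ->
  has_pd c (fun s t => 2 * s ^ 2 * t / (1 + rad s t)) x y
    match c with X1 => model_uxy x y | X2 => model_uyy x y end.
Proof.
  intros H. unfold model_uyy, model_uxy.
  destruct c; [derive_rad X1 H | derive_rad X2 H].
Qed.

Lemma has_pd_model_uxx (c : coord) (x y : R) : model_domain (x, y) ->
  has_pd c model_uxx x y
    match c with X1 => (1 - 3 * rad x y ^ 2 - 2 * rad x y ^ 3) / (2 * x ^ 3 * rad x y ^ 3)
               | X2 => 2 * y / rad x y ^ 3 end.
Proof. intros H. unfold model_uxx. destruct c; [derive_rad X1 H | derive_rad X2 H]. Qed.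

Lemma has_pd_model_curvature (c : coord) (x y : R) : model_domain (x, y) ->
  has_pd c (fun s t => 4 / rad s t ^ 3) x y
    (y * match c with X1 => 48 * x * y | X2 => 48 * x ^ 2 end / rad x y ^ 5).
Proof. intros H. destruct c; [derive_rad X1 H | derive_rad X2 H]. Qed.

Lemma open_model_domain : open model_domain.
Proof.
  assert (HU : open (fun z : R * R => 0 < fst z)).
  { intros [x y] Hx. apply (filter_imp (fun z : R * R => True /\ 0 < fst z)); [tauto|].
    apply (open_and_pos (fun _ => True) (fun s _ => s)).
    - apply open_true.
    - intros. apply continuity_2d_pt_id1.
    - now split. }
  apply (open_and_pos _ (fun s t => 1 - 4 * s ^ 2 * t ^ 2) HU).
  intros x y _.
  apply continuity_2d_pt_minus; [apply continuity_2d_pt_const|].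
  repeat apply continuity_2d_pt_mult;
    solve [apply continuity_2d_pt_const | apply continuity_2d_pt_id1
          | apply continuity_2d_pt_id2].
Qed.

Lemma smooth_on_rad : smooth_on model_domain rad.
Proof.
  pose proof open_model_domain as HU.
  apply smooth_on_ext with
    (fun s t => Rpower (1 + -4 * (s * s) * (t * t)) (/ 2)); trivial.
  - intros x y [_ H]. simpl in H. rewrite Rpower_sqrt by lra. unfold rad. f_equal. ring.
  - apply smooth_on_Rpower; trivial.
    + pose proof (smooth_on_X1 model_domain HU). pose proof (smooth_on_X2 model_domain HU).
      apply smooth_on_plus; trivial; [now apply smooth_on_const|].
      apply (smooth_on_mult model_domain (fun s t => -4 * (s * s)) (fun s t => t * t));
        trivial.
      * apply (smooth_on_mult model_domain (fun _ _ => -4) (fun s t => s * s)); trivial.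
        -- now apply smooth_on_const.
        -- now apply smooth_on_mult.
      * now apply smooth_on_mult.
    + intros x y [_ H]. simpl in H. lra.
Qed.

Lemma smooth_on_model : smooth_on model_domain model.
Proof.
  pose proof open_model_domain as HU. pose proof smooth_on_rad as Hrad.
  apply smooth_on_ext with
    (fun s t => / 2 * (ln (1 + rad s t) + -1 * rad s t) + -1 * ln s); trivial.
  { intros x y _. unfold model. field. }
  pose proof (fun r => smooth_on_const model_domain r HU) as Hc.
  apply (smooth_on_plus model_domain
    (fun s t => / 2 * (ln (1 + rad s t) + -1 * rad s t))); trivial.
  - apply (smooth_on_mult model_domain (fun _ _ => / 2)); trivial.
    apply (smooth_on_plus model_domain (fun s t => ln (1 + rad s t))); trivial.
    + apply smooth_on_ln; trivial.
      * now apply (smooth_on_plus model_domain (fun _ _ => 1)).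
      * intros x y H. destruct (rad_spec x y H) as (_ & Hs & _). lra.
    + now apply (smooth_on_mult model_domain (fun _ _ => -1)).
  - apply (smooth_on_mult model_domain (fun _ _ => -1)); trivial.
    apply smooth_on_ln; trivial.
    + now apply smooth_on_X1.
    + intros x y [H _]. exact H.
Qed.

Lemma Hess_model (i j : coord) (x y : R) : model_domain (x, y) ->
  Hess model i j x y =
  match i, j with
  | X1, X1 => model_uxx x y
  | X2, X2 => model_uyy x y
  | _, _ => model_uxy x y
  end.
Proof.
  pose proof open_model_domain as HU. intros H. unfold Hess.
  destruct j.
  - rewrite (pd_ext_on model_domain i _ (fun s t => - (1 + rad s t) / (2 * s)) HU) by
      (trivial; intros s t Hst; now apply has_pd_unique, (has_pd_model X1)).
    rewrite (has_pd_unique _ _ _ _ _ (has_pd_model_ux i x y H)). now destruct i.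
  - rewrite (pd_ext_on model_domain i _ (fun s t => 2 * s ^ 2 * t / (1 + rad s t)) HU) by
      (trivial; intros s t Hst; now apply has_pd_unique, (has_pd_model X2)).
    rewrite (has_pd_unique _ _ _ _ _ (has_pd_model_uy i x y H)). now destruct i.
Qed.

Lemma MongeAmpere_solution_model : MongeAmpere_solution model_domain model.
Proof.
  assert (Hdet : forall x y, model_domain (x, y) ->
      model_uxx x y * model_uyy x y - model_uxy x y * model_uxy x y = 1).
  { intros x y H. destruct (rad_spec x y H) as (Hx & Hs & E).
    unfold model_uxx, model_uxy, model_uyy.
    field_simplify_eq; [ring [E] | repeat split; lra]. }
  split; [exact open_model_domain|]. split; [exact smooth_on_model|].
  split; intros x y H.
  - intros v [i Hi]. unfold sumc. rewrite !Hess_model by trivial.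
    assert (Ha : 0 < model_uxx x y).
    { destruct (rad_spec x y H) as (Hx & Hs & _). unfold model_uxx.
      apply Rdiv_lt_0_compat; [lra|]. apply Rmult_lt_0_compat; trivial.
      apply Rmult_lt_0_compat; [lra|]. now apply pow_lt. }
    specialize (Hdet x y H).
    set (a := model_uxx x y) in *. set (b := model_uxy x y) in *.
    set (c := model_uyy x y) in *.
    apply Rmult_lt_reg_l with a; trivial. rewrite Rmult_0_r.
    replace (a * _) with ((a * v X1 + b * v X2) ^ 2 + (a * c - b * b) * v X2 ^ 2) by ring.
    rewrite Hdet, Rmult_1_l.
    destruct (Req_dec (v X2) 0) as [H2|H2].
    + rewrite H2, Rmult_0_r, Rplus_0_r. rewrite pow_i, Rplus_0_r by lia.
      apply pow2_gt_0. destruct i; [|now rewrite H2 in Hi].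
      apply Rmult_integral_contrapositive_currified; trivial. lra.
    + pose proof (pow2_gt_0 _ H2). pose proof (pow2_ge_0 (a * v X1 + b * v X2)). lra.
  - unfold det2. rewrite !Hess_model by trivial. now apply Hdet.
Qed.

Lemma scalar_curvature_model (x y : R) : model_domain (x, y) ->
  scalar_curvature (Hess model) x y = 4 / rad x y ^ 3.
Proof.
  intros H. rewrite (scalar_curvature_formula model_domain)
    by (trivial; exact MongeAmpere_solution_model).
  assert (Ha : forall c, pd c (Hess model X1 X1) x y = pd c model_uxx x y).
  { intros c. apply (pd_ext_on model_domain); trivial; [exact open_model_domain|].
    intros s t Hst. now rewrite Hess_model. }
  rewrite !Ha, !(has_pd_unique _ _ _ _ _ (has_pd_model_uxx _ x y H)), !Hess_model by trivial.
  destruct (rad_spec x y H) as (Hx & Hs & E). unfold model_uxx, model_uxy.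
  field_simplify_eq; [ring [E] | repeat split; lra].
Qed.

Theorem theorem1p3 :
  (forall (U : R * R -> Prop) (u : R -> R -> R),
     open U -> smooth_on U u ->
     (forall x y, U (x, y) -> pos_def (Hess u) x y) ->
     (forall x y, U (x, y) -> det2 (Hess u) x y = 1) ->
     (forall x y, U (x, y) -> 0 <= scalar_curvature (Hess u) x y) /\
     (forall alpha : R, 0 < alpha ->
        barrier_ge (Hess u) U
          (fun x y => rpow (scalar_curvature (Hess u) x y) alpha)
          (fun x y =>
             3 * alpha * rpow (scalar_curvature (Hess u) x y) (alpha + 1))))
  /\
  (forall alpha : R, 0 < alpha ->
     exists (U : R * R -> Prop) (u : R -> R -> R) (px py : R),
       open U /\ smooth_on U u /\
       (forall x y, U (x, y) -> pos_def (Hess u) x y) /\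
       (forall x y, U (x, y) -> det2 (Hess u) x y = 1) /\
       U (px, py) /\
       0 < scalar_curvature (Hess u) px py /\
       LaplaceBeltrami (Hess u)
         (fun x y => rpow (scalar_curvature (Hess u) x y) alpha) px py
       = 3 * alpha * rpow (scalar_curvature (Hess u) px py) (alpha + 1)).
Proof.
  split.
  - intros U u HU Hu Hpos Hdet.
    assert (Hsol : MongeAmpere_solution U u) by (repeat split; assumption).
    split.
    + intros x y Hxy. now apply scalar_curvature_nonneg with U.
    + intros alpha Halpha. now apply scalar_curvature_power_barrier.
  - intros alpha _. exists model_domain, model, 1, 0.
    assert (Hp : model_domain (1, 0)) by (split; simpl; lra).
    assert (Hpos : forall x y, model_domain (x, y) -> 0 < scalar_curvature (Hess model) x y).
    { intros x y H. rewrite scalar_curvature_model by trivial.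
      destruct (rad_spec x y H) as (_ & Hs & _).
      apply Rdiv_lt_0_compat; [lra|]. now apply pow_lt. }
    pose proof MongeAmpere_solution_model as Hsol. pose proof Hsol as (HU & Hu & Hdef & Hdet).
    repeat (split; [solve [auto]|]).
    apply LaplaceBeltrami_power_critical with model_domain; trivial.
    intros c. rewrite (pd_ext_on model_domain c _ _ HU scalar_curvature_model) by trivial.
    rewrite (has_pd_unique _ _ _ _ _ (has_pd_model_curvature c 1 0 Hp)). unfold Rdiv. ring.
Qed.
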